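(* Consider the $2\times2\times M$ Ising model with nearest- and next-nearest-neighbour interactions described in the context (antiferromagnetic layered Ising model when $J_1,J_2<0$), with real $J_1,J_2$ and temperature $T>0$. Let $\lambda_{\max}$ be the largest real root of the characteristic equation of the $4\times4$ matrix $\tau$ and $\mu_{\max}$ the largest real root of the characteristic equation of the $3\times3$ matrix $\tau'$ (defined in the context). Then the free energy per site $f(T)=-k_BT\lim_{M\to\infty}\frac{1}{4M}\ln Z_M$ equals $-\frac{k_BT}{4}\ln\lambda_{\max}$, the internal energy per site $u=-T^2\partial_T[f/T]$ equals $k_BT^2\partial_T[\frac14\ln\lambda_{\max}]$, the heat capacity per site $C=\partial_Tu$ equals $2k_BT\partial_T[\frac14\ln\lambda_{\max}]+k_BT^2\partial_T^2[\frac14\ln\lambda_{\max}]$, and the non-percolation probability satisfies $\lim_{M\to\infty}\frac{\ln(Z'_M/Z_M)}{M}=\ln\frac{\mu_{\max}}{\lambda_{\max}}$.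
   Context: Sites $t_i^m$, $i\in\{0,1,2,3\}$ (indices mod 4), $m\in\{0,\dots,M-1\}$, cyclically closed in $m$, spins $\sigma_i^m\in\{-1,1\}$. The cube energy is $$\mathcal H^m=-\sum_{r=0}^3\Big(J_1\big[\tfrac12\sigma_r^m\sigma_{r+1}^m+\tfrac12\sigma_r^{m+1}\sigma_{r+1}^{m+1}+\sigma_r^m\sigma_r^{m+1}\big]+J_2\big[\tfrac14\sigma_r^m\sigma_{r+2}^m+\tfrac14\sigma_r^{m+1}\sigma_{r+2}^{m+1}+\sigma_r^m\sigma_{r+1}^{m+1}+\sigma_r^m\sigma_{r-1}^{m+1}\big]\Big),$$ $\mathcal H=\sum_m\mathcal H^m$, $Z_M=\sum_\sigma e^{-\mathcal H/(k_BT)}$ over all $\sigma\in\{-1,1\}^{4M}$; $Z'_M$ is the same sum restricted to configurations with no $m,r$ such that $\sigma_r^m=\sigma_{r+1}^m=-1$. Transfer matrices: index a layer state $(s_0,\dots,s_3)$ by $k=1+\sum_i2^i(1-s_i)/2$; $\theta_{k,l}=\exp(-\mathcal H^m/(k_BT))$ with layer $m$ in state $k$, layer $m+1$ in state $l$. $\tau_{i,j}=\sum_{l\in G_j}\theta_{r_i,l}$, $(r_i)=(1,2,4,6)$, $G_1=\{1,16\}$, $G_2=\{2,3,5,8,9,12,14,15\}$, $G_3=\{4,7,10,13\}$, $G_4=\{6,11\}$; $\tau'_{i,j}=\sum_{l\in G'_j}\theta_{r'_i,l}$, $(r'_i)=(1,2,6)$, $G'_1=\{1\}$, $G'_2=\{2,3,5,9\}$,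 $G'_3=\{6,11\}$. *)

(* Defs.v *)
From mathcomp Require Import all_boot all_order all_algebra.
From mathcomp Require Import all_classical all_reals all_analysis.
Set Implicit Arguments. Unset Strict Implicit. Unset Printing Implicit Defensive.
Import Order.TTheory GRing.Theory Num.Theory numFieldNormedType.Exports.
Local Open Scope classical_set_scope.
Local Open Scope ring_scope.

Section Ising.
Variable R : realType.
Variables (kB J1 J2 : R).

Definition spin (b : bool) : R := if b then -1 else 1.

(* cube energy H^m between layer m (spins s) and layer m+1 (spins s'),
   spin vectors indexed by nat, indices taken mod 4 *)
Definition Hcube (s s' : nat -> R) : R :=
  - \sum_(r < 4)
     (J1 * (2^-1 * (s r * s ((r + 1) %% 4)%N) + 2^-1 * (s' r * s' ((r + 1) %% 4)%N)
            + s r * s' r)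
    + J2 * (4^-1 * (s r * s ((r + 2) %% 4)%N) + 4^-1 * (s' r * s' ((r + 2) %% 4)%N)
            + s r * s' ((r + 1) %% 4)%N + s r * s' ((r + 3) %% 4)%N)).

(* configurations: sigma m i = true iff sigma_i^m = -1 *)
Definition config (M : nat) := {ffun 'I_M -> {ffun 'I_4 -> bool}}.

Definition layer (x : {ffun 'I_4 -> bool}) : nat -> R :=
  fun i => spin (x (inZp i)).

Definition Htot (M : nat) (sigma : config M) : R :=
  \sum_(m < M) Hcube (layer (sigma m)) (layer (sigma (ordS m))).

Definition Z (M : nat) (T : R) : R :=
  \sum_(sigma : config M) expR (- Htot sigma / (kB * T)).

Definition nonperc (M : nat) (sigma : config M) : bool :=
  [forall m : 'I_M, forall r : 'I_4, ~~ (sigma m r && sigma m (ordS r))].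

Definition Z' (M : nat) (T : R) : R :=
  \sum_(sigma : config M | nonperc sigma) expR (- Htot sigma / (kB * T)).

(* layer state with index k (1-based, k = 1 + sum_i 2^i (1 - s_i)/2) *)
Definition state (k : nat) : nat -> R :=
  fun i => if odd ((k - 1) %/ 2 ^ (i %% 4)) then -1 else 1.

Definition theta (T : R) (k l : nat) : R :=
  expR (- Hcube (state k) (state l) / (kB * T)).

Definition r_idx : seq nat := [:: 1; 2; 4; 6]%N.
Definition G_idx : seq (seq nat) :=
  [:: [:: 1; 16]; [:: 2; 3; 5; 8; 9; 12; 14; 15]; [:: 4; 7; 10; 13]; [:: 6; 11]]%N.
Definition r'_idx : seq nat := [:: 1; 2; 6]%N.
Definition G'_idx : seq (seq nat) := [:: [:: 1]; [:: 2; 3; 5; 9]; [:: 6; 11]]%N.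

Definition tau (T : R) : 'M[R]_4 :=
  \matrix_(i < 4, j < 4) \sum_(l <- nth [::] G_idx j) theta T (nth 0%N r_idx i) l.

Definition tau' (T : R) : 'M[R]_3 :=
  \matrix_(i < 3, j < 3) \sum_(l <- nth [::] G'_idx j) theta T (nth 0%N r'_idx i) l.

Definition largest_real_root (n : nat) (A : 'M[R]_n) : R :=
  sup [set x : R | root (char_poly A) x].

Definition lambda_max (T : R) : R := largest_real_root (tau T).
Definition mu_max (T : R) : R := largest_real_root (tau' T).

Definition free_energy (T : R) : R :=
  - kB * T * lim ((fun M : nat => ln (Z M T) / (4 * M%:R)) @ \oo).

Definition internal_energy (T : R) : R :=
  - T ^+ 2 * derive1 (fun t => free_energy t / t) T.

Definition heat_capacity (T : R) : R := derive1 internal_energy T.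

End Ising.

(* Main.v *)
(**
The layer-to-layer transfer weights are positive and invariant under the rotations
of a layer (and the global spin flip), so a positive eigenvector of the lumped matrix
tau, constant along classes, lifts to a positive eigenfunction of the full transfer
operator with the same eigenvalue; integrating a cyclic chain against it bounds Z_M
above and below by multiples of lambda^M.  Perron's theorem provides this
eigenvector, by maximising t subject to t x <= x A over the simplex, and shows that
its eigenvalue is the largest real root of the characteristic polynomial and a simple
root.  Simplicity makes the root as smooth in T as the coefficients of the
characteristic polynomial, by the implicit function argument for a simple root of a
polynomial.  The same lumping applied to the layer states without adjacent minus
spins gives Z'_M.
*)
Require Import Defs.
From mathcomp Require Import all_boot all_order all_algebra.
From mathcomp Require Import all_classical all_reals all_analysis.
From mathcomp Require Import perm ring lra.
Import Order.TTheory GRing.Theory Num.Theory numFieldNormedType.Exports.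
Local Open Scope classical_set_scope.
Local Open Scope ring_scope.
Set Implicit Arguments. Unset Strict Implicit. Unset Printing Implicit Defensive.

(** * Perron's theorem: existence of a positive left eigenvector *)

Section Perron.
Variable R : realType.

Definition posmx (m n : nat) (A : 'M[R]_(m, n)) := forall i j, 0 < A i j.

Lemma posmx_tr m n (A : 'M[R]_(m, n)) : posmx A -> posmx A^T.
Proof. by move=> A0 i j; rewrite mxE. Qed.

Lemma sumr_gt0_at (I : finType) (F : I -> R) i :
  (forall j, 0 <= F j) -> 0 < F i -> 0 < \sum_j F j.
Proof.
move=> F0 Fi; rewrite (bigD1 i)//= ltr_pwDl//.
by apply: sumr_ge0 => j _; exact: F0.
Qed.

Lemma mulmx_gt0 m n p (A : 'M[R]_(m, n)) (B : 'M[R]_(n, p)) i k j :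
  (forall l, 0 <= A i l) -> 0 < A i k -> posmx B -> 0 < (A *m B) i j.
Proof.
move=> A0 Aik B0; rewrite mxE; apply: (@sumr_gt0_at _ _ k) => [l|].
  by rewrite mulr_ge0// ltW.
by rewrite mulr_gt0.
Qed.

(** The inverse of [1 + \sum_i g i / f i] serves: the sum dominates each ratio, and the 1 keeps it
    positive when [I] is empty. *)
Lemma exists_uniform_scale (I : finType) (f g : I -> R) :
  (forall i, 0 < f i) -> (forall i, 0 < g i) ->
  exists2 e, 0 < e & forall i, e * g i <= f i.
Proof.
move=> f0 g0; have S0 : 0 < 1 + \sum_i g i / f i.
  by rewrite ltr_pwDl// sumr_ge0// => i _; rewrite ltW// divr_gt0.
exists (1 + \sum_i g i / f i)^-1; first by rewrite invr_gt0.
move=> i; rewrite mulrC ler_pdivrMr// mulrC -ler_pdivrMr//.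
rewrite (bigD1 i)//= addrCA lerDl addr_ge0// sumr_ge0// => j _.
by rewrite ltW// divr_gt0.
Qed.

Lemma closed_le_fun (T : topologicalType) (f g : T -> R) :
  continuous f -> continuous g -> closed [set x | f x <= g x].
Proof.
move=> cf cg; have -> : [set x | f x <= g x] = (g \- f) @^-1` [set y | 0 <= y].
  by apply/seteqP; split => x /=; rewrite subr_ge0.
apply: closed_comp; last exact: closed_ge.
by move=> x _; apply: cvgB; [exact: cg|exact: cf].
Qed.

Lemma cvgr_sum (T : Type) (F : set_system T) (I : Type) (r : seq I) (P : pred I)
    (f : I -> T -> R) (a : I -> R) : Filter F ->
  (forall i, P i -> f i @ F --> a i) ->
  (fun x => \sum_(i <- r | P i) f i x) @ F --> \sum_(i <- r | P i) a i.
Proof.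
move=> FF fa; elim: r => [|i r IHr].
  by under eq_fun do rewrite big_nil; rewrite big_nil; exact: cvg_cst.
under eq_fun do rewrite big_cons; rewrite big_cons.
by case: ifPn => // Pi; apply: cvgD => //; exact: fa.
Qed.

Let coord_snd_continuous n (i : 'I_n) :
  continuous (fun p : R * 'rV[R]_n => p.2 0 i).
Proof.
move=> p; apply: (@continuous_comp _ _ _ snd (fun x : 'rV[R]_n => x 0 i)).
  exact: cvg_snd.
exact: coord_continuous.
Qed.

(** At a maximal [t] the defect [z = x A - t x] must vanish: a nonzero nonnegative [z] has
    [z A > 0], so [x A], rescaled to the simplex, would admit a larger [t]. *)
Lemma perron_left n (A : 'M[R]_n.+1) : posmx A ->
  exists l (u : 'rV_n.+1), [/\ 0 < l, posmx u & u *m A = l *: u].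
Proof.
move=> A0; pose B := \sum_j \sum_i A i j.
pose simplex := [set x : 'rV[R]_n.+1 |
  (forall i, 0 <= x 0 i) /\ \sum_i x 0 i = 1].
pose sub := [set p : R * 'rV[R]_n.+1 |
  forall j, p.1 * p.2 0 j <= (p.2 *m A) 0 j].
pose E := (R * 'rV[R]_n.+1)%type.
pose K := [set p : E | [/\ 0 <= p.1, simplex p.2 & sub p]].
have simplex_le1 x : simplex x -> forall i, x 0 i <= 1.
  move=> [x0 x1] i; rewrite -x1 (bigD1 i)//= lerDl sumr_ge0//.
(* Summing [t x_j <= (x A)_j] over [j] bounds [t], since the [x_j] add up to 1 and each is at most
   1. *)
have K_le p : K p -> p.1 <= B.
  case: p => t x [/= t0 xs H]; have [x0 x1] := xs.
  rewrite -[t]mulr1 -x1 mulr_sumr; apply: ler_sum => j _.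
  apply: (le_trans (H j)); rewrite mxE; apply: ler_sum => i _.
  by rewrite -[leRHS]mul1r ler_wpM2r ?simplex_le1// ltW.
have cK : compact K.
  apply: (@subclosed_compact _ _
      (`[0, B]%classic `*`
        [set x : 'rV[R]_n.+1 | forall i, `[0, 1]%classic (x ord0 i)])).
  - have -> : K = [set p : E | 0 <= p.1] `&` ((\bigcap_i [set p : E | 0 <= p.2 0 i]) `&`
        ([set p : E | \sum_i p.2 0 i <= 1] `&` [set p : E | 1 <= \sum_i p.2 0 i]) `&`
        \bigcap_j [set p : E | p.1 * p.2 0 j <= (p.2 *m A) 0 j]).
      apply/seteqP; split => p /=.
        move=> [p0 [x0 x1] H]; split => //; split; last by move=> j _; exact: H.
        by split; [move=> i _; exact: x0|split; rewrite /= x1].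
      move=> [p0 [[x0 [x1 x1']] H]]; split => //; last by move=> j; exact: H.
      by split=> [i|]; [exact: x0|apply/eqP; rewrite eq_le x1].
    have csum : continuous (fun p : R * 'rV[R]_n.+1 => \sum_i p.2 0 i).
      move=> p; apply: cvgr_sum => i _; exact: coord_snd_continuous.
    have cst_c (c : R) : continuous (fun p : R * 'rV[R]_n.+1 => c).
      by move=> p; exact: cvg_cst.
    apply: closedI; first by apply: closed_le_fun => // p; exact: cvg_fst.
    apply: closedI; last first.
      apply: closed_bigI => j _; apply: closed_le_fun => p.
        by apply: cvgM; [exact: cvg_fst|exact: coord_snd_continuous].
      under [X in continuous_at _ X]eq_fun do rewrite mxE.
      apply: cvgr_sum => i _; apply: cvgM; [exact: coord_snd_continuous|exact: cvg_cst].
    apply: closedI; last by apply: closedI; exact: closed_le_fun.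
    by apply: closed_bigI => i _; apply: closed_le_fun => //; exact: coord_snd_continuous.
  - apply: compact_setX; first exact: segment_compact.
    exact: (@rV_compact R n.+1 (fun=> `[0, 1]%classic) (fun=> @segment_compact _ _ _)).
  - move=> p Kp; have [p0 ps _] := Kp; split => /=.
      by rewrite in_itv/= p0 K_le.
    by move=> i; rewrite in_itv/= simplex_le1// andbT; case: ps.
have K0 : K !=set0.
  exists (0, delta_mx 0 0); split => //=.
    split=> [i|]; first by rewrite mxE ler0n.
    by rewrite (bigD1 ord0)//= mxE !eqxx big1 ?addr0// => i /negPf i0; rewrite mxE i0.
  move=> j /=; rewrite mul0r mxE sumr_ge0// => i _.
  by rewrite mulr_ge0 ?mxE ?ler0n// ltW.
have [[t x] /set_mem[/= t0 [x0 x1] H] tmax] := compact_EVT_max K0 cK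
  (continuous_subspaceT (fun p : R * 'rV[R]_n.+1 => cvg_fst)).
have [k xk] : exists k, 0 < x 0 k.
  apply: contrapT => /forallNP xN; have : \sum_i x 0 i <= 0.
    by apply: sumr_le0 => i _; rewrite leNgt; apply/negP/xN.
  by rewrite x1 ler10.
have xA0 j : 0 < (x *m A) 0 j by exact: (mulmx_gt0 _ _ xk).
pose z := x *m A - t *: x.
have z0 j : 0 <= z 0 j by have := H j; rewrite /z !mxE subr_ge0.
have [zE|/eqP zN] := pselect (z = 0).
  have xAE : x *m A = t *: x by apply/eqP; rewrite -subr_eq0; apply/eqP.
  have t_gt0 : 0 < t.
    rewrite lt_neqAle t0 andbT; apply/negP => /eqP tE.
    by have := xA0 ord0; rewrite xAE -tE scale0r mxE ltxx.
  exists t, x; split => // i j; rewrite ord1.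
  by have := xA0 j; rewrite xAE mxE pmulr_rgt0.
have [l zl] : exists l, 0 < z 0 l.
  apply: contrapT => /forallNP zN'; move/eqP: zN; apply; apply/rowP => j.
  rewrite [RHS]mxE; apply/eqP; rewrite eq_le z0 andbT leNgt.
  by apply/negP/zN'.
have zA0 j : 0 < (z *m A) 0 j by exact: (mulmx_gt0 _ _ zl).
(* With [e (x A) <= z A], one gets [(x A) A = t x A + z A >= (t + e) x A], against the maximality of
   [t]. *)
have [e e0 eH] := exists_uniform_scale zA0 xA0.
pose s := \sum_j (x *m A) 0 j.
have s0 : 0 < s by apply: (@sumr_gt0_at _ _ 0) => // j; exact: ltW.
have : t + e <= t.
  have Ky : K (t + e, s^-1 *: (x *m A)).
    split => /=; first by rewrite addr_ge0// ltW.
      split=> [i|]; first by rewrite mxE mulr_ge0 ?invr_ge0 ?ltW.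
      under eq_bigr do rewrite mxE.
      by rewrite -mulr_sumr mulVf// gt_eqF.
    move=> j /=; rewrite -scalemxAl [X in _ * X]mxE [leRHS]mxE mulrCA.
    rewrite ler_pM2l ?invr_gt0// mulrDl -lerBrDl.
    apply: (le_trans (eH j)); rewrite /z mulmxBl -scalemxAl.
    by rewrite [X in X <= _]mxE [X in _ + X]mxE [X in _ - X]mxE.
  exact: (tmax _ (mem_set Ky)).
by rewrite leNgt ltrDl e0.
Qed.

End Perron.

(** * Splitting an eigenvalue off the characteristic polynomial *)

Section Deflation.
Variables (F : fieldType) (m : nat).

Lemma char_poly_ublock1 l (b : 'rV[F]_m) (C : 'M[F]_m) :
  char_poly (block_mx l%:M b 0 C : 'M[F]_(1 + m)) = ('X - l%:P) * char_poly C.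
Proof.
rewrite /char_poly /char_poly_mx map_block_mx scalar_mx_block opp_block_mx.
rewrite add_block_mx map_mx0 oppr0 !add0r det_ublock det_mx11.
by congr (_ * _); rewrite !mxE.
Qed.

(* Conjugating by [v | e_1 ... e_m] makes A block triangular. *)
Lemma char_poly_deflation (A : 'M[F]_(1 + m)) (v : 'cV_(1 + m)) l :
  v 0 0 != 0 -> A *m v = l *: v ->
  exists C : 'M[F]_m, char_poly A = ('X - l%:P) * char_poly C /\
    forall x (w : 'rV_m), w *m C = x *: w ->
      exists y : 'rV_(1 + m), [/\ y *m A = x *: y, y *m v = 0 & rsubmx y = w].
Proof.
have vE : v = col_mx (v 0 0)%:M (dsubmx v).
  rewrite -[LHS]vsubmxK; congr col_mx.
  by rewrite [LHS]mx11_scalar !mxE; congr (v _ _)%:M; apply/val_inj.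
move: (v 0 0) (dsubmx v) vE => a v' -> {v} a0; rewrite -[A]submxK.
move: (ulsubmx A) (ursubmx A) (dlsubmx A) (drsubmx A) => Aul Aur Adl Adr.
rewrite mul_block_col scale_col_mx => /eq_col_mx[eu ed].
(* [b] and [C] are forced by [A P = P B] with [P = [v | e_1 ... e_m]]: the right columns say
   [a b = Aur] and [v' b + C = Adr]. *)
pose b := a^-1 *: Aur; pose C := Adr - v' *m b.
exists C; split.
  rewrite -(char_poly_ublock1 l b C).
  pose P : 'M[F]_(1 + m) := block_mx a%:M 0 v' 1%:M.
  set A' := block_mx Aul _ _ _; set B := block_mx l%:M _ _ _.
  have AP : A' *m P = P *m B.
    rewrite /A' /B /P !mulmx_block eu ed !mulmx0 !mul0mx !mulmx1 !mul1mx !add0r !addr0.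
    rewrite scale_scalar_mx -scalar_mxM mulrC mul_mx_scalar mul_scalar_mx.
    by rewrite scalerA divff// scale1r /C addrC subrK.
  have detP : \det (map_mx polyC P) != 0.
    rewrite det_map_mx/= polyC_eq0 /P det_lblock det1 mulr1 det_scalar.
    by rewrite expf_neq0.
  apply: (mulIf detP); rewrite /char_poly -[LHS]det_mulmx [RHS]mulrC -[RHS]det_mulmx.
  congr (\det _); rewrite /char_poly_mx mulmxBl mulmxBr -!map_mxM AP.
  by rewrite scalar_mxC.
(* [y0] is the first coordinate that makes [(y0, w)] orthogonal to [v]. *)
move=> x w wC; pose y0 : 'M[F]_1 := - a^-1 *: (w *m v').
exists (row_mx y0 w); rewrite row_mxKr.
have yv : row_mx y0 w *m col_mx a%:M v' = 0.
  by rewrite mul_row_col mul_mx_scalar /y0 scalerA mulrN divff// scaleN1r addNr.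
split => //; set y := row_mx y0 w; set A' := block_mx _ _ _ _.
have yAr : rsubmx (y *m A') = x *: w.
  rewrite /y /A' mul_row_block row_mxKr -wC /C mulmxBr /y0 /b -!scalemxAr.
  by rewrite -scalemxAl mulmxA scaleNr addrC.
(* The defect [y A - x y] annihilates [v] and has zero right part; as [a] is nonzero, its first
   coordinate vanishes too. *)
have : (y *m A' - x *: y) *m col_mx a%:M v' = 0.
  rewrite mulmxBl -mulmxA -scalemxAl yv scaler0 subr0 /A' mul_block_col eu ed.
  by rewrite -scale_col_mx -scalemxAr yv scaler0.
rewrite -[y *m A' - x *: y]hsubmxK mul_row_col.
have -> : rsubmx (y *m A' - x *: y) = 0.
  by rewrite linearB/= linearZ/= yAr /y row_mxKr subrr.
rewrite mul0mx addr0 mul_mx_scalar => /eqP.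
rewrite scaler_eq0 (negPf a0)/= => /eqP dl.
apply/eqP; rewrite -subr_eq0 -[_ - _]hsubmxK dl.
by rewrite linearB/= linearZ/= yAr /y row_mxKr subrr row_mx0.
Qed.

End Deflation.

(** * The Perron root is the largest real root, and it is simple *)

Section PerronRoot.
Variable R : realType.

Lemma perron_right n (A : 'M[R]_n.+1) : posmx A ->
  exists l (v : 'cV_n.+1), [/\ 0 < l, posmx v & A *m v = l *: v].
Proof.
move=> /posmx_tr/perron_left[l [u [l0 u0 uA]]].
exists l, u^T; split => //; first exact: posmx_tr.
by rewrite -[A]trmxK -trmx_mul uA linearZ.
Qed.

Variables (n : nat) (A : 'M[R]_n.+1) (v : 'cV[R]_n.+1) (l : R).
Hypotheses (A0 : posmx A) (v0 : posmx v) (Av : A *m v = l *: v).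

Lemma exists_neq0_coord (y : 'rV[R]_n.+1) : y != 0 -> exists k, y 0 k != 0.
Proof.
move=> y0; apply: contrapT => /forallNP yN; move/eqP: y0; apply; apply/rowP => k.
by rewrite [RHS]mxE; have [|/yN] := eqVneq (y 0 k) 0.
Qed.

Lemma exists_neg_coord (y : 'rV[R]_n.+1) :
  y != 0 -> y *m v = 0 -> exists k, y 0 k < 0.
Proof.
move=> /exists_neq0_coord[k yk] yv; apply: contrapT => /forallNP yN.
have y0 i : 0 <= y 0 i by rewrite leNgt; apply/negP/yN.
have : 0 < (y *m v) 0 0.
  by apply: (@mulmx_gt0 _ _ _ _ _ _ _ k) => //; rewrite lt_neqAle eq_sym yk y0.
by rewrite yv mxE ltxx.
Qed.

(** The triangle inequality in each coordinate of [y A], the entries of [A] being their own absolute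
    values. *)
Lemma norm_left_eigenvector (y : 'rV[R]_n.+1) x j : y *m A = x *: y ->
  x * (map_mx Num.norm y) 0 j <= (map_mx Num.norm y *m A) 0 j.
Proof.
move=> /(congr1 (fun y : 'rV_n.+1 => `|y 0 j|)).
rewrite [X in _ = `|X|]mxE normrM => yAj.
apply: (@le_trans _ _ (`|x| * (map_mx Num.norm y) 0 j)).
  by rewrite mxE ler_wpM2r// ler_norm.
rewrite [map_mx _ _ _ j]mxE -yAj !mxE; apply: (le_trans (ler_norm_sum _ _ _)).
by apply: ler_sum => i _; rewrite normrM mxE (gtr0_norm (A0 _ _)).
Qed.

(** Pairing [x |y| <= |y| A] with [v] gives [x (|y| v) <= l (|y| v)], and [|y| v] is positive. *)
Lemma perron_root_max x : root (char_poly A) x -> x <= l.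
Proof.
rewrite -eigenvalue_root_char => /eigenvalueP[y yA yN0].
pose z : 'rV[R]_n.+1 := map_mx Num.norm y.
have [k yk] := exists_neq0_coord yN0.
have zv0 : 0 < (z *m v) 0 0.
  apply: (@mulmx_gt0 _ _ _ _ _ _ _ k) => //; first by move=> j; rewrite mxE.
  by rewrite mxE normr_gt0.
have zA j : x * z 0 j <= (z *m A) 0 j by exact: norm_left_eigenvector.
have : (x *: z *m v) 0 0 <= (z *m A *m v) 0 0.
  rewrite mxE [leRHS]mxE; apply: ler_sum => j _.
  by rewrite ler_wpM2r ?(ltW (v0 _ _))// mxE.
rewrite -mulmxA Av -scalemxAl -scalemxAr mxE [leRHS]mxE.
by rewrite ler_pM2r.
Qed.

(* A left eigenvector y for l orthogonal to v > 0 changes sign, so that |y| A >= l |y|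
   with a strict inequality somewhere, against A v = l v. *)
Lemma perron_root_simple :
  exists2 q : {poly R}, char_poly A = q * ('X - l%:P) & q.[l] != 0.
Proof.
have [C [AE lift]] := @char_poly_deflation _ n A v l (lt0r_neq0 (v0 0 0)) Av.
exists (char_poly C); first by rewrite mulrC.
apply/negP; rewrite -[_ == 0]/(root _ _) -eigenvalue_root_char.
move=> /eigenvalueP[w /lift[y [yA yv yw]] w0].
have y_neq0 : y != 0 by apply: contra_neq w0 => y0; rewrite -yw y0 linear0.
have [i yi] := exists_neg_coord y_neq0 yv.
have [k] : exists k, (- y) 0 k < 0.
  by apply: exists_neg_coord; rewrite ?oppr_eq0// mulNmx yv oppr0.
rewrite mxE oppr_lt0 => yk.
pose z : 'rV[R]_n.+1 := map_mx Num.norm y.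
have zA j : l * z 0 j <= (z *m A) 0 j by exact: norm_left_eigenvector.
(* At [k] the entry of [y] is positive, so the gap is the sum of the [(|y_j| - y_j) A_jk]; its term
   at [i], where [y_i < 0], is positive. *)
have zAk : l * z 0 k < (z *m A) 0 k.
  rewrite [z 0 k]mxE gtr0_norm// (_ : _ * _ = (y *m A) 0 k); last by rewrite yA mxE.
  rewrite !mxE -subr_gt0 -sumrB; apply: (@sumr_gt0_at _ _ _ i) => [j|].
    by rewrite -mulrBl mulr_ge0 ?(ltW (A0 _ _))// subr_ge0 mxE ler_norm.
  by rewrite -mulrBl mulr_gt0// mxE ltr0_norm//; lra.
have : (l *: z *m v) 0 0 < (z *m A *m v) 0 0.
  rewrite mxE [ltRHS]mxE -subr_gt0 -sumrB; apply: (@sumr_gt0_at _ _ _ k) => [j|].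
    by rewrite -mulrBl mulr_ge0 ?(ltW (v0 _ _))// subr_ge0 mxE.
  by rewrite -mulrBl mulr_gt0// subr_gt0 mxE.
by rewrite -mulmxA Av -scalemxAl -scalemxAr ltxx.
Qed.

(** The root [l] bounds all real roots, so the [sup] is attained there. Any positive right
    eigenvector thus reveals the largest real root as its eigenvalue. *)
Lemma largest_real_root_perron : largest_real_root A = l.
Proof.
have [q AE _] := perron_root_simple.
have Al : [set x | root (char_poly A) x] l.
  by rewrite /= AE rootM root_XsubC eqxx orbT.
apply/eqP; rewrite eq_le; apply/andP; split.
  by apply: ge_sup; [exists l|exact: perron_root_max].
by apply: ub_le_sup => //; exists l => x; exact: perron_root_max.
Qed.

End PerronRoot.

(** * Weighted sums over paths and cycles of states *)

Section TransferSum.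
Variables (R : realType) (S : finType) (P : pred S).
Implicit Types (th : S -> S -> R) (V h : S -> R).

Definition ffun_cons M (x : S) (s : {ffun 'I_M -> S}) : {ffun 'I_M.+1 -> S} :=
  [ffun i => if unlift ord0 i is Some j then s j else x].

Lemma ffun_cons0 M x (s : {ffun 'I_M -> S}) : ffun_cons x s ord0 = x.
Proof. by rewrite ffunE unlift_none. Qed.

Lemma ffun_consS M x (s : {ffun 'I_M -> S}) i :
  ffun_cons x s (lift ord0 i) = s i.
Proof. by rewrite ffunE liftK. Qed.

Lemma forall_ffun_cons M x (s : {ffun 'I_M -> S}) :
  [forall i, P (ffun_cons x s i)] = P x && [forall i, P (s i)].
Proof.
apply/forallP/andP => [H|[Px /forallP H] i].
  split; first by have := H ord0; rewrite ffun_cons0.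
  by apply/forallP => i; have := H (lift ord0 i); rewrite ffun_consS.
by case: (unliftP ord0 i) => [j|] ->; rewrite ?ffun_cons0 ?ffun_consS.
Qed.

Lemma big_ffun_cons M (F : {ffun 'I_M.+1 -> S} -> R) :
  \sum_(s : {ffun 'I_M.+1 -> S} | [forall i, P (s i)]) F s =
  \sum_(x | P x) \sum_(s : {ffun 'I_M -> S} | [forall i, P (s i)]) F (ffun_cons x s).
Proof.
rewrite pair_big (reindex (fun p => ffun_cons p.1 p.2))/=.
  by apply: eq_bigl => -[x s]; rewrite forall_ffun_cons.
exists (fun s : {ffun 'I_M.+1 -> S} => (s ord0, [ffun i => s (lift ord0 i)])).
  move=> [x s] _ /=; rewrite ffun_cons0; congr pair.
  by apply/ffunP => i; rewrite ffunE ffun_consS.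
move=> s _ /=; apply/ffunP => i.
by case: (unliftP ord0 i) => [j|] ->; rewrite ?ffun_cons0// ffun_consS ffunE.
Qed.

Definition path_weight th M (s : {ffun 'I_M.+1 -> S}) : R :=
  \prod_(i < M) th (s (widen_ord (leqnSn M) i)) (s (lift ord0 i)).

Lemma path_weight_cons th M x (s : {ffun 'I_M.+1 -> S}) :
  path_weight th (ffun_cons x s) = th x (s ord0) * path_weight th s.
Proof.
rewrite /path_weight big_ord_recl; congr (_ * _).
  by rewrite ffun_consS (_ : widen_ord _ _ = ord0) ?ffun_cons0//; exact/val_inj.
apply: eq_bigr => i _; rewrite ffun_consS.
rewrite (_ : widen_ord _ _ = lift ord0 (widen_ord (leqnSn M) i)) ?ffun_consS//.
exact/val_inj.
Qed.

Lemma cycle_weightE th M (s : {ffun 'I_M.+1 -> S}) :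
  \prod_(i < M.+1) th (s i) (s (ordS i)) = path_weight th s * th (s ord_max) (s ord0).
Proof.
rewrite big_ord_recr/=; congr (_ * th _ (s _)); last first.
  by apply/val_inj; rewrite /= modnn.
rewrite /path_weight; apply: eq_bigr => i _; congr (th _ (s _)).
by apply/val_inj; rewrite /= modn_small// ltnS ltn_ord.
Qed.

(** Summing out the first state turns [h] into [\sum_x h x * th x y], a weight on the next state, so
    [h] varies in the induction; the eigenvalue equation then extracts one factor [l]. *)
Lemma path_sum_eigenfun th V l (thV : forall x, P x ->
    \sum_(y | P y) th x y * V y = l * V x) M h :
  \sum_(s : {ffun 'I_M.+1 -> S} | [forall i, P (s i)])
     h (s ord0) * (path_weight th s * V (s ord_max)) =
  l ^+ M * \sum_(x | P x) h x * V x.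
Proof.
elim: M h => [|M IH] h; rewrite big_ffun_cons.
  rewrite mul1r; apply: eq_bigr => x Px.
  rewrite (bigD1 [ffun=> x])/=; last by apply/forallP => -[].
  rewrite big1 ?addr0; last first.
    by move=> s /andP[_ /eqP[]]; apply/ffunP => -[].
  rewrite /path_weight big_ord0 mul1r ffun_cons0.
  by rewrite (_ : ord_max = ord0) ?ffun_cons0//; exact/val_inj.
rewrite exchange_big/=.
transitivity (\sum_(s : {ffun 'I_M.+1 -> S} | [forall i, P (s i)])
    (\sum_(x | P x) h x * th x (s ord0)) * (path_weight th s * V (s ord_max))).
  apply: eq_bigr => s _; rewrite mulr_suml; apply: eq_bigr => x _.
  rewrite ffun_cons0 path_weight_cons -!mulrA; congr (_ * (_ * (_ * V _))).
  by rewrite (_ : ord_max = lift ord0 ord_max) ?ffun_consS//; exact/val_inj.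
rewrite (IH (fun y => \sum_(x | P x) h x * th x y)) exprSr -mulrA; congr (_ * _).
under [LHS]eq_bigr do rewrite /= mulr_suml.
rewrite exchange_big mulr_sumr; apply: eq_bigr => x Px /=.
by rewrite mulrCA -thV// mulr_sumr; apply: eq_bigr => y _; rewrite mulrA.
Qed.

(** A cycle is a path times a closing factor. On finitely many states that factor is comparable, up
    to positive constants, to [V] at the last state, and the path sum against [V] is exactly
    geometric. *)
Lemma cycle_sum_bounds th V l x0 : P x0 -> 0 < l ->
  (forall x y, 0 < th x y) -> (forall x, 0 < V x) ->
  (forall x, P x -> \sum_(y | P y) th x y * V y = l * V x) ->
  exists c1 c2, [/\ 0 < c1, 0 < c2 & forall M,
    c1 * l ^+ M <= \sum_(s : {ffun 'I_M.+1 -> S} | [forall i, P (s i)])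
      \prod_(i < M.+1) th (s i) (s (ordS i)) <= c2 * l ^+ M].
Proof.
move=> Px0 l0 th0 V0 thV.
have W0 : 0 < \sum_(x | P x) 1 * V x.
  rewrite (bigD1 x0)//= mul1r ltr_pwDl// sumr_ge0// => x _.
  by rewrite mul1r ltW.
have [e e0 eP] := @exists_uniform_scale R (S * S)%type
  (fun p => th p.1 p.2) (fun p => V p.1) (fun p => th0 _ _) (fun p => V0 _).
have [d d0 dP] := @exists_uniform_scale R (S * S)%type
  (fun p => V p.1) (fun p => th p.1 p.2) (fun p => V0 _) (fun p => th0 _ _).
have pw0 M (s : {ffun 'I_M.+1 -> S}) : 0 <= path_weight th s.
  by rewrite prodr_ge0// => i _; rewrite ltW.
exists (e * \sum_(x | P x) 1 * V x), (d^-1 * \sum_(x | P x) 1 * V x).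
split; rewrite ?mulr_gt0 ?invr_gt0// => M.
rewrite -!mulrA ![_ * l ^+ M]mulrC -(path_sum_eigenfun thV) !mulr_sumr.
apply/andP; split; apply: ler_sum => s _; rewrite cycle_weightE mul1r mulrCA.
  by rewrite ler_wpM2l// (eP (_, _)).
by rewrite ler_wpM2l// mulrC ler_pdivlMr// mulrC (dP (_, _)).
Qed.

(** A cycle of [M + 1] layers contains a path of [M] steps, whence the shift. The shift and the
    constants only contribute [(ln c - ln l) / (M + 1)]. *)
Lemma cvg_ln_geometric (u : nat -> R) c1 c2 l : 0 < c1 -> 0 < c2 -> 0 < l ->
  (forall M, c1 * l ^+ M <= u M.+1 <= c2 * l ^+ M) ->
  (fun M : nat => ln (u M) / M%:R) @ \oo --> ln l.
Proof.
move=> c10 c20 l0 uP; rewrite -cvg_shiftS /=.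
have lnc c M : 0 < c -> ln (c * l ^+ M) / M.+1%:R = ln l + (ln c - ln l) * harmonic M.
  move=> c0; rewrite lnM ?posrE ?exprn_gt0// lnXn// -mulr_natl /harmonic/=.
  rewrite -natr1; field.
  by rewrite natr1 pnatr_eq0.
have lim c : (fun M => ln l + (ln c - ln l) * harmonic M) @ \oo --> ln l.
  rewrite -[X in _ --> X]addr0 -[X in _ --> _ + X](mulr0 (ln c - ln l)).
  apply: cvgD; first exact: cvg_cst.
  by apply: cvgM; [exact: cvg_cst|exact: cvg_harmonic].
apply: (squeeze_cvgr _ (lim c1) (lim c2)); near=> M.
have /andP[lo hi] := uP M.
have u0 : 0 < u M.+1 by rewrite (lt_le_trans _ lo)// mulr_gt0// exprn_gt0.
rewrite -!lnc// !ler_pM2r ?invr_gt0 ?ltr0n// !ler_ln ?posrE ?lo ?hi//.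
  by rewrite mulr_gt0// exprn_gt0.
by rewrite mulr_gt0// exprn_gt0.
Unshelve. all: by end_near. Qed.

End TransferSum.

(** * Layer states, broken bonds and symmetry classes *)

Definition bit (k i : nat) : bool := odd ((k - 1) %/ 2 ^ (i %% 4)).

(* [discord k l] counts the broken bonds between the layer states k and l, the
   J1 bonds with weights 1, 1, 2 and the J2 bonds with weights 1, 1, 4, 4. *)
Definition discord (k l : nat) : nat * nat :=
  (sumn [seq ((bit k r (+) bit k ((r + 1) %% 4)) + (bit l r (+) bit l ((r + 1) %% 4))
            + 2 * (bit k r (+) bit l r))%N | r <- iota 0 4],
   sumn [seq ((bit k r (+) bit k ((r + 2) %% 4)) + (bit l r (+) bit l ((r + 2) %% 4))
            + 4 * (bit k r (+) bit l ((r + 1) %% 4))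
            + 4 * (bit k r (+) bit l ((r + 3) %% 4)))%N | r <- iota 0 4]).

Definition class_of (G : seq (seq nat)) (k : nat) : nat :=
  find (fun g => k \in g) G.

(* States of a same class are related by a symmetry of the cube, hence see every
   class through the same multiset of energies. *)
Definition lumpable (G : seq (seq nat)) (r : seq nat) : bool :=
  [&& all (fun j => all (fun l => class_of G l == j) (nth [::] G j))
          (iota 0 (size G)),
      all (fun k => all (fun g =>
            perm_eq (map (discord k) g) (map (discord (nth 0%N r (class_of G k))) g)) G)
          (flatten G)
    & perm_eq (flatten G) [seq k <- iota 1 16 | k \in flatten G]].

Lemma lumpable_G : lumpable G_idx r_idx.
Proof. by vm_compute. Qed.

Lemma lumpable_G' : lumpable G'_idx r'_idx.
Proof. by vm_compute. Qed.

Notation layer_state := {ffun 'I_4 -> bool}.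

Definition code (x : layer_state) : nat :=
  (1 + (x (inZp 0) + (2 * x (inZp 1) + (4 * x (inZp 2) + 8 * x (inZp 3)))))%N.

Lemma bit_code (x : layer_state) (i : 'I_4) : bit (code x) i = x i.
Proof.
rewrite /code -[in RHS](valZpK i).
case: i => -[|[|[|[|//]]]] ? /=;
  by case: (x (inZp 0)) (x (inZp 1)) (x (inZp 2)) (x (inZp 3)) => -[] [] [].
Qed.

Lemma code_inj : injective code.
Proof. by move=> x y xy; apply/ffunP => i; rewrite -!bit_code xy. Qed.

Lemma code_iota (x : layer_state) : code x \in iota 1 16.
Proof.
rewrite /code.
by case: (x (inZp 0)) (x (inZp 1)) (x (inZp 2)) (x (inZp 3)) => -[] [] [].
Qed.

(** Pigeonhole: [code] is injective on the sixteen layer states and takes its values in a list of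
    length sixteen. *)
Lemma perm_code : perm_eq [seq code x | x <- enum {: layer_state}] (iota 1 16).
Proof.
have us : uniq [seq code x | x <- enum {: layer_state}].
  by rewrite map_inj_uniq ?enum_uniq//; exact: code_inj.
apply: uniq_perm => //.
apply: (uniq_min_size us _ _).2 => [k /mapP[x _ ->]|]; first exact: code_iota.
by rewrite size_map -cardE card_ffun card_bool card_ord.
Qed.

Lemma nonperc_code (x : layer_state) :
  [forall r : 'I_4, ~~ (x r && x (ordS r))] = (code x \in flatten G'_idx).
Proof.
transitivity (all (fun r => ~~ (bit (code x) r && bit (code x) (r + 1))) (iota 0 4)).
  apply/forallP/allP => [H r|H r].
    rewrite mem_iota => /= r4; have := H (Ordinal r4); rewrite -!bit_code.
    by rewrite /bit /= modn_mod addn1.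
  have := H r; rewrite mem_iota ltn_ord -!bit_code => /(_ isT).
  by rewrite /bit /= modn_mod addn1.
(* The two tests are compared by computation on all sixteen codes. *)
have /allP := (isT : all (fun k =>
  all (fun r => ~~ (bit k r && bit k (r + 1))) (iota 0 4) == (k \in flatten G'_idx))
  (iota 1 16)).
by move=> /(_ _ (code_iota x)) /eqP.
Qed.

(** * Lumping the transfer operator of the Ising model *)

Section Ising.
Variables (R : realType) (kB J1 J2 T : R).

Lemma stateM k l i j :
  state R k i * state R l j = 1 - 2 * (bit k i (+) bit l j)%:R.
Proof.
rewrite /state -/(bit k i) -/(bit l j).
by case: (bit k i); case: (bit l j) => /=; ring.
Qed.

(** Each spin product is 1 minus twice its broken-bond bit. Aligned layers contribute
    [4 (1/2 + 1/2 + 1) = 8] to [J1] and [4 (1/4 + 1/4 + 1 + 1) = 10] to [J2]; the [J2] weights of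
    [discord] are doubled to be integers, hence the division by 2. *)
Lemma Hcube_discord k l : - Hcube J1 J2 (state R k) (state R l) =
  J1 * (8 - (discord k l).1%:R) + J2 * (10 - (discord k l).2%:R / 2).
Proof.
rewrite /Hcube opprK.
rewrite -(big_mkord xpredT (fun r =>
    J1 * (_ * (state R k r * state R k ((r + 1) %% 4)%N)
          + _ * (state R l r * state R l ((r + 1) %% 4)%N)
          + state R k r * state R l r)
    + J2 * (_ * (state R k r * state R k ((r + 2) %% 4)%N)
          + _ * (state R l r * state R l ((r + 2) %% 4)%N)
          + state R k r * state R l ((r + 1) %% 4)%N
          + state R k r * state R l ((r + 3) %% 4)%N))).
rewrite /index_iota subn0 /discord !sumnE !big_map !big_cons !big_nil !stateM.
by rewrite !natrD; field.
Qed.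

Definition discord_weight (d : nat * nat) : R :=
  expR ((J1 * (8 - d.1%:R) + J2 * (10 - d.2%:R / 2)) / (kB * T)).

Lemma theta_discord k l : theta kB J1 J2 T k l = discord_weight (discord k l).
Proof. by rewrite /theta Hcube_discord. Qed.

Lemma layer_code (x : layer_state) i : (i < 4)%N -> layer R x i = state R (code x) i.
Proof.
move=> i4; rewrite /layer /spin /state -/(bit (code x) i).
by rewrite -(bit_code x (inZp i)) /bit /= modn_mod.
Qed.

Lemma Hcube_code (x y : layer_state) :
  Hcube J1 J2 (layer R x) (layer R y) =
  Hcube J1 J2 (state R (code x)) (state R (code y)).
Proof.
rewrite /Hcube; congr (- _); apply: eq_bigr => r _.
by rewrite !layer_code// ltn_mod.
Qed.

Definition lumped_mx n (G : seq (seq nat)) (r : seq nat) : 'M[R]_n :=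
  \matrix_(i < n, j < n) \sum_(l <- nth [::] G j) theta kB J1 J2 T (nth 0%N r i) l.

(** The Boltzmann weight depends only on [discord], and lumpability gives both rows the same
    multiset of values of [discord] on [g]. *)
Lemma class_row_sum G r k g : lumpable G r -> k \in flatten G -> g \in G ->
  \sum_(l <- g) theta kB J1 J2 T k l =
  \sum_(l <- g) theta kB J1 J2 T (nth 0%N r (class_of G k)) l.
Proof.
move=> /and3P[_ /allP H _] kG gG.
under eq_bigr do rewrite theta_discord.
under [RHS]eq_bigr do rewrite theta_discord.
rewrite -(big_map (discord k) xpredT discord_weight).
rewrite -(big_map (discord (nth 0%N r (class_of G k))) xpredT discord_weight).
by apply: perm_big; have /allP := H k kG; exact.
Qed.

Lemma class_of_lt G k : k \in flatten G -> (class_of G k < size G)%N.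
Proof. by move=> /flattenP[g gG kg]; rewrite -has_find; apply/hasP; exists g. Qed.

(** The lift of [v] is constant on classes, so the sum over states groups into class sums, and these
    agree with those of the representative, the entries of the lumped matrix. *)
Lemma lumped_eigenvector n G r (v : 'cV[R]_n.+1) lam k :
  lumpable G r -> size G = n.+1 -> lumped_mx n.+1 G r *m v = lam *: v ->
  k \in flatten G ->
  \sum_(l <- flatten G) theta kB J1 J2 T k l * v (inord (class_of G l)) 0 =
  lam * v (inord (class_of G k)) 0.
Proof.
move=> Gr Gn Av kG; have ck := class_of_lt kG; rewrite Gn in ck.
have -> : lam * v (inord (class_of G k)) 0 =
    (lumped_mx n.+1 G r *m v) (inord (class_of G k)) 0 by rewrite Av mxE.
rewrite big_flatten/= (big_nth [::]) Gn big_mkord mxE; apply: eq_bigr => j _.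
have jG : nth [::] G j \in G by rewrite mem_nth// Gn.
rewrite mxE inordK// -class_row_sum// mulr_suml; apply: eq_big_seq => l lj.
have /and3P[/allP/(_ (nat_of_ord j)) + _ _] := Gr.
rewrite mem_iota Gn ltn_ord => /(_ isT)/allP/(_ _ lj)/eqP ->.
by rewrite inord_val.
Qed.

Lemma big_code G r (F : nat -> R) : lumpable G r ->
  \sum_(x : layer_state | code x \in flatten G) F (code x) = \sum_(l <- flatten G) F l.
Proof.
move=> /and3P[_ _ GP]; rewrite (perm_big _ GP) big_filter/= -(perm_big _ perm_code)/=.
by rewrite big_map big_enum_cond.
Qed.

Lemma lumped_mx_gt0 n G r : all (fun g => g != [::]) G -> size G = n ->
  posmx (lumped_mx n G r).
Proof.
move=> /allP G0 Gn i j; rewrite mxE.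
have : nth [::] G j != [::] by apply: G0; rewrite mem_nth// Gn.
case: (nth _ _ _) => [//|l g _]; rewrite big_cons ltr_pwDl ?expR_gt0//.
by rewrite sumr_ge0// => ? _; rewrite expR_ge0.
Qed.

Lemma cycle_weight_expR M (s : config M) :
  expR (- Htot J1 J2 s / (kB * T)) =
  \prod_(m < M) theta kB J1 J2 T (code (s m)) (code (s (ordS m))).
Proof.
rewrite /Htot -sumrN mulr_suml expR_sum.
by apply: eq_bigr => m _; rewrite /theta Hcube_code.
Qed.

(** Serves both partition functions: the classes of [G_idx] give all configurations, those of
    [G'_idx] the non-percolating ones. *)
Lemma cvg_restricted_partition n G r (A := lumped_mx n.+1 G r) (u : nat -> R) :
  lumpable G r -> size G = n.+1 -> all (fun g => g != [::]) G ->
  (1 \in flatten G)%N ->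
  (forall M, u M = \sum_(s : config M | [forall m, code (s m) \in flatten G])
     expR (- Htot J1 J2 s / (kB * T))) ->
  (fun M : nat => ln (u M) / M%:R) @ \oo --> ln (largest_real_root A).
Proof.
move=> Gr Gn G0 G1 uE; have A0 : posmx A by exact: lumped_mx_gt0.
have [lam [v [lam0 v0 Av]]] := perron_right A0.
rewrite (largest_real_root_perron A0 v0 Av).
(* The layer of plus spins has code 1; it is the admissible state that the cycle bounds ask for. *)
have c0 : code [ffun=> false] \in flatten G.
  by rewrite /code !ffunE.
have [] := @cycle_sum_bounds R layer_state (fun x => code x \in flatten G)
  (fun x y => theta kB J1 J2 T (code x) (code y))
  (fun x => v (inord (class_of G (code x))) 0) lam [ffun=> false] c0 lam0.
- by move=> x y; exact: expR_gt0.
- by move=> x; exact: v0.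
- move=> x xG; rewrite -(lumped_eigenvector Gr Gn Av xG).
  exact: (big_code (fun l => theta kB J1 J2 T (code x) l * v (inord (class_of G l)) 0) Gr).
move=> c1 [c2 [c10 c20 H]]; apply: (cvg_ln_geometric c10 c20 lam0) => M.
by rewrite uE; under eq_bigr do rewrite cycle_weight_expR; exact: H.
Qed.

End Ising.

(** * Repeated differentiability on the positive half-line *)

Section SmoothHalfLine.
Variable R : realType.
Implicit Types (f g : R -> R) (n : nat).

(** The derivative is a witness rather than [derive1], so that closure properties can be proved with
    explicit formulas; only positive arguments count, as these are temperatures. *)
Fixpoint smooth n f : Prop :=
  if n is n'.+1 then
    exists2 f1 : R -> R, (forall t : R, 0 < t -> is_derive t 1 f (f1 t)) & smooth n' f1
  else True.

Lemma near_gt0 (t : R) : 0 < t -> \forall s \near t, 0 < s.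
Proof. exact: lt_nbhsr. Qed.

Lemma smooth_ext n f g :
  (forall t, 0 < t -> f t = g t) -> smooth n f -> smooth n g.
Proof.
case: n => [//|n] fg [f1 df sf1]; exists f1 => // t t0.
apply: near_eq_is_derive (df t t0); near=> s; apply: fg.
near: s; exact: near_gt0.
Unshelve. all: by end_near. Qed.

Lemma smoothW n f : smooth n.+1 f -> smooth n f.
Proof.
elim: n f => [//|n IH] f [f1 df sf1]; exists f1 => //.
exact: IH.
Qed.

Lemma smooth_derive1 n f : smooth n.+1 f ->
  (forall t : R, 0 < t -> is_derive t 1 f (derive1 f t)) /\ smooth n (derive1 f).
Proof.
move=> [f1 df sf1]; have f1E t : 0 < t -> derive1 f t = f1 t.
  by move=> t0; rewrite derive1E; have [] := df t t0.
split=> [t t0|]; first by rewrite f1E//; exact: df.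
by apply: smooth_ext sf1 => t t0; rewrite f1E.
Qed.

Lemma smooth_cst n c : smooth n (fun=> c).
Proof.
elim: n c => [//|n IH] c; exists (fun=> 0); last exact: IH.
by move=> t _; exact: is_derive_cst.
Qed.

Lemma smooth_id n : smooth n id.
Proof.
case: n => [//|n]; exists (fun=> 1); last exact: smooth_cst.
by move=> t _; exact: is_derive_id.
Qed.

Lemma smoothD n f g :
  smooth n f -> smooth n g -> smooth n (fun t => f t + g t).
Proof.
elim: n f g => [//|n IH] f g [f1 df sf1] [g1 dg sg1].
exists (fun t => f1 t + g1 t); last exact: IH.
by move=> t t0; apply: (@is_deriveD _ _ _ f g); [exact: df|exact: dg].
Qed.

Lemma smoothM n f g :
  smooth n f -> smooth n g -> smooth n (fun t => f t * g t).
Proof.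
elim: n f g => [//|n IH] f g sf sg.
have [[f1 df sf1] [g1 dg sg1]] := (sf, sg).
exists (fun t => f t * g1 t + g t * f1 t).
  by move=> t t0; apply: (@is_deriveM _ _ f g); [exact: df|exact: dg].
by apply: smoothD; apply: IH => //; exact: smoothW.
Qed.

Lemma smoothN n f : smooth n f -> smooth n (fun t => - f t).
Proof.
move=> sf; have := smoothM (smooth_cst n (-1)) sf.
by apply: smooth_ext => t _; rewrite mulN1r.
Qed.

(** The derivative contains the inverse itself, but one order lower, which is what the induction
    provides. *)
Lemma smoothV n f : (forall t, 0 < t -> f t != 0) ->
  smooth n f -> smooth n (fun t => (f t)^-1).
Proof.
move=> f0; elim: n => [//|n IH] sf; have [f1 df sf1] := sf.
have sfV : smooth n (fun t => (f t)^-1) by apply: IH; exact: smoothW.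
exists (fun t => - (f t)^-1 * (f t)^-1 * f1 t).
  move=> t t0; have := is_deriveV (f0 t t0) (df t t0).
  by move=> H; apply: is_derive_eq H _; rewrite -exprVn expr2 mulNr.
by apply: smoothM => //; apply: smoothM => //; exact: smoothN.
Qed.

Lemma smooth_expR n f : smooth n f -> smooth n (fun t => expR (f t)).
Proof.
elim: n => [//|n IH] sf; have [f1 df sf1] := sf.
exists (fun t => expR (f t) * f1 t).
  by move=> t t0; exact: (is_derive1_comp (is_derive_expR _) (df t t0)).
by apply: smoothM => //; apply: IH; exact: smoothW.
Qed.

Lemma smooth_ln n f : (forall t, 0 < t -> 0 < f t) ->
  smooth n f -> smooth n (fun t => ln (f t)).
Proof.
case: n => [//|n] f0 sf; have [f1 df sf1] := sf.
exists (fun t => (f t)^-1 * f1 t).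
  by move=> t t0; exact: (is_derive1_comp (is_derive1_ln (f0 _ t0)) (df t t0)).
apply: smoothM => //; apply: smoothV; last exact: smoothW.
by move=> t t0; rewrite lt0r_neq0// f0.
Qed.

Lemma smoothX n f k : smooth n f -> smooth n (fun t => f t ^+ k).
Proof.
move=> sf; elim: k => [|k IH]; first exact: smooth_cst.
by apply: smooth_ext (smoothM sf IH) => t _; rewrite exprS.
Qed.

Lemma smooth_sum n (I : Type) (r : seq I) (f : I -> R -> R) :
  (forall i, smooth n (f i)) -> smooth n (fun t => \sum_(i <- r) f i t).
Proof.
move=> sf; elim: r => [|i r IH].
  by apply: smooth_ext (smooth_cst n 0) => t _; rewrite big_nil.
by apply: smooth_ext (smoothD (sf i) IH) => t _; rewrite big_cons.
Qed.

Definition smooth_poly n (p : R -> {poly R}) := forall i, smooth n (fun t => (p t)`_i).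

Lemma smooth_polyM n p q :
  smooth_poly n p -> smooth_poly n q -> smooth_poly n (fun t => p t * q t).
Proof.
move=> sp sq i; apply: (@smooth_ext _ (fun t => \sum_(j < i.+1) (p t)`_j * (q t)`_(i - j))).
  by move=> t _; rewrite coefM.
by apply: smooth_sum => j; apply: smoothM.
Qed.

Lemma smooth_poly_cst n p : smooth_poly n (fun=> p).
Proof. by move=> i; exact: smooth_cst. Qed.

Lemma smooth_poly_prod n (I : Type) (r : seq I) (p : I -> R -> {poly R}) :
  (forall i, smooth_poly n (p i)) -> smooth_poly n (fun t => \prod_(i <- r) p i t).
Proof.
move=> sp; elim: r => [|i r IH] k.
  by apply: smooth_ext (smooth_poly_cst n 1 k) => t _; rewrite big_nil.
by apply: smooth_ext (smooth_polyM (sp i) IH k) => t _; rewrite big_cons.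
Qed.

(** By the Leibniz formula the coefficients are polynomials in the entries. *)
Lemma smooth_char_poly n m (A : R -> 'M[R]_m) :
  (forall i j, smooth n (fun t => A t i j)) ->
  smooth_poly n (fun t => char_poly (A t)).
Proof.
move=> sA k; apply: (@smooth_ext _ (fun t => \sum_(s : 'S_m)
    ((-1) ^+ s * \prod_i char_poly_mx (A t) i (s i) : {poly R})`_k)).
  by move=> t _; rewrite -coef_sum.
apply: smooth_sum => s.
apply: (@smooth_polyM n (fun=> _) _); first exact: smooth_poly_cst.
apply: smooth_poly_prod => i {}k.
apply: (@smooth_ext _ (fun t => ('X *+ (i == s i))`_k - (k == 0%N)%:R * A t i (s i))).
  by move=> t _; rewrite !mxE coefB coefC; case: (k == 0%N); rewrite ?mul1r ?mul0r.
apply: smoothD; first exact: smooth_cst.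
by apply: smoothN; apply: smoothM => //; exact: smooth_cst.
Qed.

(* The chord of [l] between t and t + h is the quotient of the chords of the
   coefficients by the cofactor of ['X - l t] in [p t]. *)
Lemma is_derive_simple_root (N : nat) (p : R -> {poly R}) (dc : nat -> R)
    (l : R -> R) (t : R) :
  (forall s, size (p s) <= N)%N ->
  (forall i, is_derive t 1 (fun s => (p s)`_i) (dc i)) ->
  (forall s, (p s).[l s] = 0) -> {for t, continuous l} ->
  (p t)^`().[l t] != 0 ->
  is_derive t 1 l (- (\sum_(i < N) dc i * l t ^+ i) / (p t)^`().[l t]).
Proof.
move=> pN dp pl cl pl0.
have /factor_theorem[q pE] : root (p t) (l t) by apply/eqP.
have qE : (p t)^`().[l t] = q.[l t].
  by rewrite pE derivM derivXsubC mulr1 hornerD hornerM hornerXsubC subrr mulr0 add0r.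
have clh : (fun h : R => l (h *: 1 + t)) @ 0^' --> l t.
  rewrite (_ : (fun _ => _) = l \o shift t); first exact/continuous_withinNshiftx.
  by apply/funext => h /=; rewrite [h *: 1]mulr1.
have cq : (fun h : R => q.[l (h *: 1 + t)]) @ 0^' --> q.[l t].
  by apply: (cvg_comp _ _ clh); exact: continuous_horner.
suff H : (fun h : R => h^-1 *: ((l \o shift t) (h *: 1) - l t)) @ 0^' -->
    - (\sum_(i < N) dc i * l t ^+ i) / (p t)^`().[l t].
  by split; [exact: cvgP H|exact: cvg_lim H].
have chord : (fun h : R => - (\sum_(i < N) (h^-1 *: ((p (h *: 1 + t))`_i - (p t)`_i)) *
    l (h *: 1 + t) ^+ i) / q.[l (h *: 1 + t)]) @ 0^' -->
    - (\sum_(i < N) dc i * l t ^+ i) / (p t)^`().[l t].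
  rewrite qE; apply: cvgM; last by apply: cvgV => //; rewrite -qE.
  apply: cvgN; apply: cvgr_sum => i _; apply: cvgM.
    have [dpi <-] := dp i; exact: dpi.
  exact: (@cvg_comp _ _ _ _ (fun x : R => x ^+ i) _ _ _ clh (@exprn_continuous R i _)).
apply: cvg_trans chord; apply: near_eq_cvg; near=> h.
have h0 : h != 0 by near: h; exact: nbhs_dnbhs_neq.
have q0 : q.[l (h *: 1 + t)] != 0.
  by near: h; apply: (cvgr_neq0 _ cq); rewrite -qE.
rewrite /=; set x := l (h *: 1 + t).
(* [x] is a root of the polynomial at [t + h], so the increment of the coefficients, evaluated at
   [x], is [- q.[x] (x - l t)]; dividing by [- q.[x]] isolates the chord of [l]. *)
have : (p (h *: 1 + t)).[x] - (p t).[x] = - (p t).[x] by rewrite pl sub0r.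
rewrite {2}pE hornerM hornerXsubC (horner_coef_wide _ (pN _)) (horner_coef_wide _ (pN _)).
rewrite -sumrB => E.
under eq_bigr do rewrite -scalerAl mulrBl.
rewrite -scaler_sumr E scalerN opprK -scalerAl; congr (_ *: _).
by rewrite mulrC mulKf.
Unshelve. all: by end_near. Qed.

(** Bootstrapping: the derivative of [l] is a quotient of expressions in [l], the coefficients and
    their derivatives, so order [n] for [l] gives order [n + 1]. *)
Lemma smooth_simple_root N (p : R -> {poly R}) (l : R -> R) :
  (forall s, size (p s) <= N)%N -> (forall n, smooth_poly n p) ->
  (forall s, (p s).[l s] = 0) -> (forall t, 0 < t -> {for t, continuous l}) ->
  (forall t, 0 < t -> (p t)^`().[l t] != 0) ->
  forall n, smooth n l.
Proof.
move=> pN sp pl cl pl0; elim=> [//|n IH].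
exists (fun t => - (\sum_(i < N) derive1 (fun s => (p s)`_i) t * l t ^+ i) /
  (p t)^`().[l t]).
  move=> t t0; apply: (@is_derive_simple_root N p
    (fun i => derive1 (fun s => (p s)`_i) t)) => //.
  - by move=> i; have [+ _] := smooth_derive1 (sp 1%N i); exact.
  - exact: cl.
  - exact: pl0.
apply: smoothM.
  apply: smoothN; apply: smooth_sum => i; apply: smoothM; last exact: smoothX.
  by have [_] := smooth_derive1 (sp n.+1 i).
apply: smoothV => //.
apply: (@smooth_ext _ (fun t => \sum_(i < N) ((p t)`_i.+1 *+ i.+1) * l t ^+ i)).
  move=> t t0; rewrite (@horner_coef_wide _ N); last first.
    by rewrite (leq_trans (size_poly _ _))// (leq_trans (leq_pred _)).
  by apply: eq_bigr => i _; rewrite coef_deriv.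
apply: smooth_sum => i; apply: smoothM; last exact: smoothX.
apply: (@smooth_ext _ (fun t => i.+1%:R * (p t)`_i.+1)).
  by move=> t _; rewrite mulr_natl.
by apply: smoothM; [exact: smooth_cst|exact: sp].
Qed.

End SmoothHalfLine.

(** * Dependence of the Perron root on the matrix *)

Section PerronDependence.
Variables (R : realType) (n : nat).

(* Pair a left Perron vector of B with a right Perron vector of A. *)
Lemma perron_root_mono (A B : 'M[R]_n.+1) (a b : R) : posmx A -> posmx B ->
  (forall i j, a * A i j <= b * B i j) ->
  a * largest_real_root A <= b * largest_real_root B.
Proof.
move=> A0 B0 AB.
have [la [v [_ v0 Av]]] := perron_right A0; have [lb [w [_ w0 Bw]]] := perron_right B0.
rewrite (largest_real_root_perron A0 v0 Av) (largest_real_root_perron B0 w0 Bw).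
have [lb' [u [_ u0 uB]]] := perron_left B0.
have pos (x : 'cV[R]_n.+1) : posmx x -> 0 < (u *m x) 0 0.
  by move=> x0; apply: (@mulmx_gt0 _ _ _ _ _ _ _ 0) => // j; rewrite ltW.
(* The left and right Perron eigenvalues of [B] agree: evaluate [u B w] both ways and divide by
   [u w > 0]. *)
have lbE : lb' = lb.
  apply: (mulIf (lt0r_neq0 (pos _ w0))).
  have : (u *m B *m w) 0 0 = (u *m (B *m w)) 0 0 by rewrite mulmxA.
  by rewrite Bw uB -scalemxAl -scalemxAr [LHS]mxE [RHS]mxE.
rewrite -(ler_pM2r (pos _ v0)).
have -> : a * la * (u *m v) 0 0 = (u *m (a *: A *m v)) 0 0.
  by rewrite -scalemxAl Av scalerA -scalemxAr [RHS]mxE.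
have -> : b * lb * (u *m v) 0 0 = (u *m (b *: B *m v)) 0 0.
  by rewrite -scalemxAl -scalemxAr mulmxA uB lbE -scalemxAl scalerA [RHS]mxE.
rewrite mxE [leRHS]mxE; apply: ler_sum => i _; rewrite ler_wpM2l ?(ltW (u0 _ _))//.
rewrite mxE [leRHS]mxE; apply: ler_sum => j _; rewrite ler_wpM2r ?(ltW (v0 _ _))//.
by rewrite mxE [leRHS]mxE.
Qed.

Lemma largest_real_root_gt0 (A : 'M[R]_n.+1) : posmx A -> 0 < largest_real_root A.
Proof.
move=> A0; have [la [v [la0 v0 Av]]] := perron_right A0.
by rewrite (largest_real_root_perron A0 v0 Av).
Qed.

(** Near [t] the entries of [A s] lie between [1 - d] and [1 + d] times those of [A t], and
    monotonicity passes these factors to the roots; [d = e / l] turns the relative error into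
    [e]. *)
Lemma continuous_perron_root (A : R -> 'M[R]_n.+1) (t : R) :
  (forall s, posmx (A s)) -> (forall i j, {for t, continuous (fun s => A s i j)}) ->
  {for t, continuous (fun s => largest_real_root (A s))}.
Proof.
move=> A0 cA; apply/cvgrPdist_le => /= e e0.
have l0 := largest_real_root_gt0 (A0 t); set l := largest_real_root (A t) in l0 *.
pose d := e / l; have d0 : 0 < d by rewrite divr_gt0.
have near_entry : \forall s \near t, forall ij : 'I_n.+1 * 'I_n.+1,
    `|A t ij.1 ij.2 - A s ij.1 ij.2| <= d * A t ij.1 ij.2.
  apply: (@filter_forall _ _ (fun (ij : 'I_n.+1 * 'I_n.+1) s =>
    `|A t ij.1 ij.2 - A s ij.1 ij.2| <= d * A t ij.1 ij.2) _ (nbhs_filter t)) => -[i j] /=.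
  have /cvgrPdist_le := cA i j.
  by apply; rewrite mulr_gt0// A0.
apply: filterS near_entry => s entry.
have H i j : `|A t i j - A s i j| <= d * A t i j by exact: (entry (i, j)).
have up : 1 * largest_real_root (A s) <= (1 + d) * l.
  apply: perron_root_mono => // i j; have := H i j; rewrite ler_norml => /andP[]; lra.
have lo : (1 - d) * l <= 1 * largest_real_root (A s).
  apply: perron_root_mono => // i j; have := H i j; rewrite ler_norml => /andP[]; lra.
have dl : d * l = e by rewrite /d divfK// lt0r_neq0.
rewrite ler_norml; apply/andP; split; lra.
Qed.

Lemma smooth_perron_root (A : R -> 'M[R]_n.+1) :
  (forall s, posmx (A s)) -> (forall k i j, smooth k (fun t => A t i j)) ->
  forall k, smooth k (fun t => largest_real_root (A t)).
Proof.
move=> A0 sA; have simple s : exists2 q : {poly R},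
    char_poly (A s) = q * ('X - (largest_real_root (A s))%:P) &
    q.[largest_real_root (A s)] != 0.
  have [la [v [_ v0 Av]]] := perron_right (A0 s).
  rewrite (largest_real_root_perron (A0 s) v0 Av).
  exact: perron_root_simple (A0 s) v0 Av.
apply: (@smooth_simple_root R n.+2 (fun t => char_poly (A t))) => [s|k|s|t t0|t t0].
- by rewrite size_char_poly.
- by apply: smooth_char_poly => i j; exact: sA.
- by have [q -> _] := simple s; rewrite hornerM hornerXsubC subrr mulr0.
- apply: continuous_perron_root => // i j.
  have [f1 df _] := sA 1%N i j; have [dA _] := df t t0.
  exact/differentiable_continuous/derivable1_diffP.
- have [q -> q0] := simple t.
  by rewrite derivM derivXsubC mulr1 hornerD hornerM hornerXsubC subrr mulr0 add0r.
Qed.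

End PerronDependence.

(** * Thermodynamic quantities and the non-percolation probability *)

Section IsingThermodynamics.
Variables (R : realType) (kB J1 J2 : R).

(** Positivity holds at every real [T], even at 0, where the division yields 0; [smooth_perron_root]
    quantifies over all of them. *)
Lemma tau_gt0 T : posmx (tau kB J1 J2 T).
Proof. exact: lumped_mx_gt0. Qed.

Lemma tau'_gt0 T : posmx (tau' kB J1 J2 T).
Proof. exact: lumped_mx_gt0. Qed.

Lemma cvg_ln_Z T :
  (fun M : nat => ln (Z kB J1 J2 M T) / M%:R) @ \oo --> ln (lambda_max kB J1 J2 T).
Proof.
apply: (cvg_restricted_partition lumpable_G) => // M.
(* The four classes exhaust the sixteen states, so no configuration is excluded. *)
apply: eq_bigl => s; apply/esym/forallP => m.
by have /allP := (isT : all (mem (flatten G_idx)) (iota 1 16)); apply; exact: code_iota.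
Qed.

Lemma cvg_ln_Z' T :
  (fun M : nat => ln (Z' kB J1 J2 M T) / M%:R) @ \oo --> ln (mu_max kB J1 J2 T).
Proof.
apply: (cvg_restricted_partition lumpable_G') => // M.
by apply: eq_bigl => s; apply: eq_forallb => m; rewrite nonperc_code.
Qed.

Lemma Z_gt0 M T : 0 < Z kB J1 J2 M T.
Proof.
by apply: (@sumr_gt0_at _ _ _ [ffun=> [ffun=> false]]) => [s|]; rewrite ?expR_ge0 ?expR_gt0.
Qed.

Lemma Z'_gt0 M T : 0 < Z' kB J1 J2 M T.
Proof.
rewrite /Z' (bigD1 [ffun=> [ffun=> false]])/=; last first.
  by apply/forallP => m; apply/forallP => r; rewrite !ffunE.
by rewrite ltr_pwDl ?expR_gt0// sumr_ge0// => s _; rewrite expR_ge0.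
Qed.

Lemma smooth_lambda_max k : 0 < kB -> smooth k (lambda_max kB J1 J2).
Proof.
move=> kB0; apply: smooth_perron_root => [s|{}k i j]; first exact: tau_gt0.
apply: (@smooth_ext _ _ (fun t => \sum_(l <- nth [::] G_idx j)
    theta kB J1 J2 t (nth 0%N r_idx i) l)); first by move=> t _; rewrite mxE.
apply: smooth_sum => l; apply: smooth_expR; apply: smoothM; first exact: smooth_cst.
apply: smoothV; first by move=> t t0; rewrite mulf_neq0 ?lt0r_neq0.
by apply: smoothM; [exact: smooth_cst|exact: smooth_id].
Qed.

Lemma cvg_ln_Z_site T :
  (fun M : nat => ln (Z kB J1 J2 M T) / (4 * M%:R)) @ \oo -->
  4^-1 * ln (lambda_max kB J1 J2 T).
Proof.
under eq_fun do rewrite invfM mulrCA.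
by apply: cvgM; [exact: cvg_cst|exact: cvg_ln_Z].
Qed.

Lemma free_energyE T :
  free_energy kB J1 J2 T = - (kB * T / 4) * ln (lambda_max kB J1 J2 T).
Proof.
by rewrite /free_energy (cvg_lim _ (cvg_ln_Z_site (T := T)))//; ring.
Qed.

(** The factor [t] cancels for [t] nonzero, and equality near [T] suffices for the derivative. *)
Lemma is_derive_free_energy_div (g1 T : R) : 0 < T ->
  is_derive T 1 (fun t => 4^-1 * ln (lambda_max kB J1 J2 t)) g1 ->
  is_derive T 1 (fun t => free_energy kB J1 J2 t / t) (- kB * g1).
Proof.
set g := fun t => _; move=> T0 dg.
apply: near_eq_is_derive (is_deriveZ (- kB) dg).
near=> t; rewrite /g free_energyE /= /GRing.scale/=; field.
by apply: lt0r_neq0; near: t; exact: near_gt0.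
Unshelve. all: by end_near. Qed.

End IsingThermodynamics.

(** As [lim] and [derive1] are total, with default values, convergence and derivability are asserted
    beside the formulas. *)
Theorem theorem7 (R : realType) (kB J1 J2 T : R) (hkB : 0 < kB) (hT : 0 < T) :
  let lam := lambda_max kB J1 J2 in
  let mu := mu_max kB J1 J2 in
  let g := fun t : R => 4^-1 * ln (lam t) in
  [/\ (fun M : nat => ln (Z kB J1 J2 M T) / (4 * M%:R)) @ \oo --> g T,
      free_energy kB J1 J2 T = - (kB * T / 4) * ln (lam T),
      derivable (fun t => free_energy kB J1 J2 t / t) T 1
        /\ internal_energy kB J1 J2 T = kB * T ^+ 2 * derive1 g T,
      [/\ derivable g T 1, derivable (derive1 g) T 1,
          derivable (internal_energy kB J1 J2) T 1 &
          heat_capacity kB J1 J2 T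
            = 2 * kB * T * derive1 g T + kB * T ^+ 2 * derive1 (derive1 g) T] &
      (fun M : nat => ln (Z' kB J1 J2 M T / Z kB J1 J2 M T) / M%:R) @ \oo
        --> ln (mu T / lam T)].
Proof.
move=> lam mu g.
have lam0 t : 0 < lam t by apply: largest_real_root_gt0; exact: tau_gt0.
have mu0 t : 0 < mu t by apply: largest_real_root_gt0; exact: tau'_gt0.
(* Two orders, since the heat capacity involves the second derivative of [g]. *)
have sg : smooth 2 g.
  apply: smoothM; first exact: smooth_cst.
  by apply: smooth_ln => //; exact: smooth_lambda_max.
have [dg sg1] := smooth_derive1 sg; have [dg1 _] := smooth_derive1 sg1.
(* Stated for all positive [t]: the internal energy is differentiated again, so its formula must
   hold in a neighbourhood of [T]. *)
have dfe (t : R) : 0 < t ->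
    is_derive t 1 (fun t => free_energy kB J1 J2 t / t) (- kB * derive1 g t).
  by move=> t0; exact: (is_derive_free_energy_div t0 (dg t t0)).
have uE (t : R) : 0 < t -> internal_energy kB J1 J2 t = kB * t ^+ 2 * derive1 g t.
  move=> t0; rewrite /internal_energy derive1E; have [_ ->] := dfe t t0.
  by ring.
have du : is_derive T 1 (internal_energy kB J1 J2)
    (2 * kB * T * derive1 g T + kB * T ^+ 2 * derive1 (derive1 g) T).
  have dsq : is_derive T 1 (fun t : R => kB * t ^+ 2) (kB * (2 * T)).
    apply: (@is_deriveZ _ _ _ (fun t : R => t ^+ 2) kB).
    by apply: is_derive_eq (is_deriveX 2 (is_derive_id T 1)) _; rewrite /= expr1 [_ *: _]mulr1.
  apply: near_eq_is_derive (is_derive_eq (is_deriveM dsq (dg1 T hT)) _).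
    near=> t; rewrite uE//; near: t; exact: near_gt0.
  by rewrite /GRing.scale/=; ring.
split.
- exact: cvg_ln_Z_site.
- exact: free_energyE.
- by split; [have [] := dfe T hT|exact: uE].
- split; [by have [] := dg T hT|by have [] := dg1 T hT|by have [] := du|].
  by rewrite /heat_capacity derive1E; have [_ ->] := du.
- have -> : ln (mu T / lam T) = ln (mu T) - ln (lam T) by rewrite ln_div ?posrE.
  (* The logarithm splits for every [M], including 0, as the all-plus configuration makes both sums
     positive. *)
  under eq_fun do rewrite ln_div ?posrE ?Z_gt0 ?Z'_gt0// mulrBl.
  by apply: cvgB; [exact: cvg_ln_Z'|exact: cvg_ln_Z].
Unshelve. all: by end_near. Qed.
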